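(* Consider a finite MDP with state space $\mathcal S$, action space $\mathcal A$, transition kernel $P$, deterministic reward function $r(s,a,s')$, discount $\gamma\in[0,1)$ and optimal Q-function $Q^*$. Let $\beta>0$. Let $(s_k,a_k,s_k')_{k\ge0}$ be i.i.d. triples where $s_k\sim p$ for a fixed state distribution $p$, $a_k\sim b(\cdot\mid s_k)$ for a fixed behavior policy $b$, $s_k'\sim P(\cdot\mid s_k,a_k)$, and assume $d(s,a):=p(s)b(a\mid s)>0$ for all $(s,a)$. Let $Q^A_0,Q^B_0$ be arbitrary and define (SGT2-QL) $$Q^A_{k+1}(s_k,a_k)=Q^A_k(s_k,a_k)+\alpha_k\Big(r(s_k,a_k,s_k')+\gamma\max_{a}Q^B_k(s_k',a)-Q^A_k(s_k,a_k)+\beta\big(Q^B_k(s_k,a_k)-Q^A_k(s_k,a_k)\big)\Big),$$ $$Q^B_{k+1}(s_k,a_k)=Q^B_k(s_k,a_k)+\alpha_k\Big(r(s_k,a_k,s_k')+\gamma\max_{a}Q^A_k(s_k',a)-Q^B_k(s_k,a_k)+\beta\big(Q^A_k(s_k,a_k)-Q^B_k(s_k,a_k)\big)\Big),$$ with all other entries unchanged. If $0\le\alpha_k\le1$, $\sum_k\alpha_k=\infty$ and $\sum_k\alpha_k^2<\infty$, then $Q^A_k\to Q^*$ and $Q^B_k\to Q^*$ with probability one.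
   Context: $Q^*$ is the unique solution of $Q^*(s,a)=\sum_{s'}P(s'\mid s,a)\big(r(s,a,s')+\gamma\max_{a'}Q^*(s',a')\big)$. There are no terminal states. *)

(* Defs.v *)
From HB Require Import structures.
From mathcomp Require Import all_boot all_order all_algebra.
From mathcomp Require Import all_classical all_reals all_analysis.
Set Implicit Arguments. Unset Strict Implicit. Unset Printing Implicit Defensive.
Import Order.TTheory GRing.Theory Num.Theory.
Local Open Scope classical_set_scope.
Local Open Scope ring_scope.

(* max_a q(s,a) over the finite action set (0 if there is no action at all). *)
Definition maxQ (R : realType) (S A : finType) (q : S -> A -> R) (s : S) : R :=
  match [pick a : A] with
  | Some a0 => \big[Num.max/q s a0]_(a : A) q s a
  | None => 0
  end.

Definition sgt2_step (R : realType) (S A : finType)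
  (r : S -> A -> S -> R) (gamma beta al : R)
  (Q : (S -> A -> R) * (S -> A -> R)) (x : S * A * S) :
  (S -> A -> R) * (S -> A -> R) :=
  let: (qa, qb) := Q in
  let: (s, a, s') := x in
  (fun s1 a1 => if (s1 == s) && (a1 == a) then
      qa s a + al * (r s a s' + gamma * maxQ qb s' - qa s a + beta * (qb s a - qa s a))
    else qa s1 a1,
   fun s1 a1 => if (s1 == s) && (a1 == a) then
      qb s a + al * (r s a s' + gamma * maxQ qa s' - qb s a + beta * (qa s a - qb s a))
    else qb s1 a1).

Fixpoint sgt2_iter (R : realType) (S A : finType)
  (r : S -> A -> S -> R) (gamma beta : R) (alpha : nat -> R)
  (QA0 QB0 : S -> A -> R) (x : nat -> S * A * S) (k : nat) :
  (S -> A -> R) * (S -> A -> R) :=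
  match k with
  | 0 => (QA0, QB0)
  | k'.+1 => sgt2_step r gamma beta (alpha k')
               (sgt2_iter r gamma beta alpha QA0 QB0 x k') (x k')
  end.

(* The samples X_k = (s_k, a_k, s'_k) are i.i.d. with
   P(X_k = (s,a,s')) = p(s) b(a|s) P(s'|s,a): for any finitely many distinct
   indices, the joint law is the product of these marginals. *)
Definition iid_samples (R : realType) (d : measure_display) (T : measurableType d)
  (Pr : probability T R) (S A : finType) (X : nat -> T -> S * A * S)
  (law : S * A * S -> R) : Prop :=
  (forall k x, measurable (X k @^-1` [set x])) /\
  (forall (n : nat) (ks : 'I_n -> nat) (xs : 'I_n -> S * A * S),
     injective ks ->
     Pr (\bigcap_(i in [set: 'I_n]) (X (ks i) @^-1` [set xs i]))
       = (\prod_(i < n) law (xs i))%:E).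

(* Main.v *)
Require Import Defs.
From HB Require Import structures.
From mathcomp Require Import all_boot all_order all_algebra.
From mathcomp Require Import all_classical all_reals all_analysis.
From mathcomp Require Import ring lra.
Set Implicit Arguments. Unset Strict Implicit. Unset Printing Implicit Defensive.
Import Order.TTheory GRing.Theory Num.Theory.
Import numFieldNormedType.Exports.
Local Open Scope classical_set_scope.
Local Open Scope ring_scope.

(* Writing e = Q - Q^* for the pair of errors, indexed by (component, s, a),
   the recursion reads
     e_{k+1} = e_k + alpha_k (g (H_k - e_k) + xi_k),  g = d(s,a) (1 + beta),
   where H_k is a function of Q_k with |H_k| <= c |e_k| in sup norm,
   c = (gamma + beta) / (1 + beta) < 1, and xi_k is centered given the past.
   Once alpha_k (1 + beta) <= 1, an update is a convex combination that keeps a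
   large enough ball invariant, so the iterates, hence the xi_k, are bounded by
   a deterministic constant.  The samples take finitely many values, so
   Kolmogorov's maximal inequality can be proved by induction on cylinders of
   histories; with sum alpha_k^2 < oo it gives almost sure convergence of
   sum alpha_k xi_k.  On that event, adding the tail of this series to e_k
   leaves a weighted averaging of targets bounded by c |e_k| + o(1), and
   sum alpha_k = oo shrinks any eventual bound on |e_k| by a fixed factor. *)

Lemma ler_norm_total (R : realType) (I : finType) (F : I -> R) i :
  `|F i| <= \sum_j `|F j|.
Proof. by rewrite (bigD1 i)//= lerDl sumr_ge0. Qed.

(** * Deterministic averaging recursions and noisy contractions *)

Section Averaging.
Context {R : realType}.
Implicit Types (u h a alpha : nat -> R).

(** Induction on [n]. The weight left on [u K] is a product of factors [1 - a k]; it stays below the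
    inverse of [1 + s], [s] the sum of the weights, because [(1 - x) * (1 + s + x) <= 1 + s] for
    [x, s >= 0]. *)
Lemma averaging_bound u h a (B : R) (K : nat) :
  0 <= B -> (forall k, (K <= k)%N -> 0 <= a k <= 1) ->
  (forall k, (K <= k)%N -> u k.+1 = (1 - a k) * u k + a k * h k) ->
  (forall k, (K <= k)%N -> `|h k| <= B) ->
  forall n, `|u (K + n)%N| <= B + `|u K| / (1 + \sum_(i < n) a (K + i)%N).
Proof.
move=> B0 a01 uS hB; elim=> [|n IHn].
  by rewrite addn0 big_ord0 addr0 divr1 lerDr.
rewrite addnS uS ?leq_addr// big_ord_recr/=.
have /andP[a0 a1] := a01 _ (leq_addr n K).
have S0 : 0 <= \sum_(i < n) a (K + i)%N.
  by apply: sumr_ge0 => i _; have /andP[] := a01 _ (leq_addr i K).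
have hn := hB _ (leq_addr n K).
set x := a (K + n)%N in a0 a1 *; set s := \sum_(i < n) _ in IHn S0 *.
have step : (1 - x) * (`|u K| / (1 + s)) <= `|u K| / (1 + (s + x)).
  rewrite mulrCA ler_wpM2l// ler_pdivrMr; last by lra.
  rewrite mulrC ler_pdivlMr; last by lra.
  nra.
apply: (le_trans (ler_normD _ _)); rewrite !normrM (ger0_norm a0).
rewrite (@ger0_norm _ (1 - x)); last by lra.
have H1 : (1 - x) * `|u (K + n)%N| <= (1 - x) * (B + `|u K| / (1 + s)).
  by rewrite ler_wpM2l//; lra.
have H2 : x * `|h (K + n)%N| <= x * B by rewrite ler_wpM2l.
nra.
Qed.

Lemma averaging_limsup u h a (B : R) (K : nat) :
  0 <= B -> (forall k, (K <= k)%N -> 0 <= a k <= 1) ->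
  series a @ \oo --> +oo ->
  (forall k, (K <= k)%N -> u k.+1 = (1 - a k) * u k + a k * h k) ->
  (forall k, (K <= k)%N -> `|h k| <= B) ->
  forall eps, 0 < eps -> \forall k \near \oo, `|u k| <= B + eps.
Proof.
move=> B0 a01 aoo uS hB eps eps0.
have bnd := @averaging_bound u h a B K B0 a01 uS hB.
(* Past this threshold the weights accumulated since [K] exceed [|u K| / eps], so the residual term
   is at most [eps]. *)
move/cvgryPge: aoo => /(_ (`|u K| / eps + series a K)) ev.
near=> k.
have Kk : (K <= k)%N by near: k; exact: nbhs_infty_ge.
have : `|u K| / eps + series a K <= series a k by near: k; exact: ev.
have -> : series a k = series a K + \sum_(i < k - K) a (K + i)%N.
  rewrite /series/= (big_cat_nat (leq0n K) Kk)/=; congr (_ + _).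
  rewrite -{1}(add0n K) big_addn big_mkord.
  by apply: eq_bigr => i _; rewrite addnC.
rewrite addrC lerD2l => sge.
rewrite -(subnKC Kk); apply: (le_trans (bnd _)); rewrite lerD2l.
have s0 : 0 <= `|u K| / eps by rewrite divr_ge0// ltW.
rewrite ler_pdivrMr; last by lra.
move: sge; rewrite ler_pdivrMr// => sge; nra.
Unshelve. all: by end_near. Qed.

(* Absorbing the tail of the noise series into the error turns the recursion
   into an averaging one with target bounded by [c * B + o(1)]. *)
Lemma noisy_contraction_step (u H xi alpha : nat -> R) (g c B : R) :
  0 < g -> 0 <= c -> c < 1 -> 0 < B ->
  (forall k, 0 <= alpha k) -> alpha @ \oo --> 0 -> series alpha @ \oo --> +oo ->
  (forall k, u k.+1 = u k + alpha k * (g * (H k - u k) + xi k)) ->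
  cvgn (series (fun k => alpha k * xi k)) ->
  (\forall k \near \oo, `|H k| <= c * B) ->
  \forall k \near \oo, `|u k| <= (1 + c) / 2 * B.
Proof.
move=> g0 c0 c1 B0 al0 alcv alS uS /cvg_ex[/= L Lcv] HB.
pose N k := L - series (fun k => alpha k * xi k) k.
have Ncv : N @ \oo --> (0 : R).
  by rewrite -(subrr L); apply: cvgB => //; exact: cvg_cst.
(* The final bound spends [3 * d]: noise tail in the target, slack of the averaging limit, and
   removal of [N k]. The available gap [(1 + c) / 2 * B - c * B] is [4 * d]. *)
pose d : R := (1 - c) * B / 8.
have d0 : 0 < d by rewrite /d; nra.
have dE : d * 8 = (1 - c) * B by rewrite /d; field.
have Nd : \forall k \near \oo, `|N k| <= d.
  by move/cvgr0Pnorm_le : Ncv; apply.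
have ald : \forall k \near \oo, g * alpha k <= 1.
  have /cvgr0Pnorm_le : (fun k => g * alpha k) @ \oo --> (0 : R).
    by rewrite -(mulr0 g); apply: cvgM => //; exact: cvg_cst.
  move=> /(_ 1 ltr01); apply: filterS => k; apply: le_trans; exact: ler_norm.
have [K _ KP] : \forall k \near \oo,
    [/\ `|H k| <= c * B, `|N k| <= d & g * alpha k <= 1].
  by apply: filterS3 HB Nd ald => k.
(* Since [N k.+1 = N k - alpha k * xi k], the noise cancels in [u + N], which averages towards
   [H k + N k] with weight [g * alpha k]. *)
have ev : \forall k \near \oo, `|u k + N k| <= c * B + d + d.
  apply: (@averaging_limsup _ (fun k => H k + N k) (fun k => g * alpha k) _ K) => //.
  - by nra.
  - by move=> k /KP[_ _ ->]; rewrite andbT mulr_ge0 ?(ltW g0).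
  - have -> : series (fun k => g * alpha k) = (fun n => g * series alpha n).
      by apply/funext => n; rewrite /series/= mulr_sumr.
    apply/cvgryPge => M.
    move/cvgryPge: alS => /(_ (M / g)); apply: filterS => n.
    by rewrite ler_pdivrMr// mulrC.
  - move=> k _; rewrite /N /series/= big_nat_recr//= uS; ring.
  - move=> k /KP[Hk Nk _]; apply: (le_trans (ler_normD _ _)); exact: lerD.
near=> k.
have -> : u k = (u k + N k) - N k by ring.
apply: (le_trans (ler_normB _ _)).
have h1 : `|u k + N k| <= c * B + d + d by near: k.
have h2 : `|N k| <= d by near: k.
lra.
Unshelve. all: by end_near. Qed.

(** The one-step shrinking is iterated on geometric bounds. [H] is controlled by the sup norm, so
    each bound must hold for all coordinates at once; finiteness of [I] provides this. *)
Lemma noisy_contraction_cvg0 (I : finType) (e H xi : nat -> I -> R)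
    (g : I -> R) alpha (c M : R) :
  (forall i, 0 < g i) -> 0 <= c -> c < 1 ->
  (forall k, 0 <= alpha k) -> alpha @ \oo --> 0 -> series alpha @ \oo --> +oo ->
  (forall k i, e k.+1 i = e k i + alpha k * (g i * (H k i - e k i) + xi k i)) ->
  (forall i, cvgn (series (fun k => alpha k * xi k i))) ->
  (forall k B, 0 <= B -> (forall i, `|e k i| <= B) ->
     forall i, `|H k i| <= c * B) ->
  (forall k i, `|e k i| <= M) ->
  forall i, e ^~ i @ \oo --> 0.
Proof.
move=> g0 c0 c1 al0 alcv alS eS xicv HB eM i0.
pose q := (1 + c) / 2; pose D := `|M| + 1.
have q0 : 0 < q by rewrite /q; lra.
have q1 : `|q| < 1 by rewrite gtr0_norm// /q; lra.
have D0 : 0 < D by rewrite /D; have := normr_ge0 M; lra.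
have geo j : \forall k \near \oo, forall i, `|e k i| <= q ^+ j * D.
  elim: j => [|j IHj].
    near=> k => i; rewrite expr0 mul1r /D.
    have := eM k i; have := ler_norm M; lra.
  have BD : 0 < q ^+ j * D by rewrite mulr_gt0// exprn_gt0.
  apply: filter_forall => i.
  rewrite exprS -mulrA.
  apply: (@noisy_contraction_step _ (H ^~ i) (xi ^~ i) alpha (g i)) => //.
  apply: filterS IHj => k ek; apply: HB => //; exact: ltW.
apply/cvgr0Pnorm_le => eps eps0.
have : (fun j => q ^+ j * D) @ \oo --> (0 : R).
  rewrite -(mul0r D); apply: cvgM; [exact: cvg_expr | exact: cvg_cst].
move=> /cvgr0Pnorm_le /(_ _ eps0)[j _ /(_ j (leqnn j)) /= jP].
apply: filterS (geo j) => k /(_ i0) /le_trans; apply.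
exact: le_trans (ler_norm _) jP.
Unshelve. all: by end_near. Qed.

End Averaging.

(* Histories are stored in reverse order, so that the latest sample is the
   head of the list. *)
Fixpoint rhist (T Y : Type) (X : nat -> T -> Y) (n : nat) (t : T) : seq Y :=
  if n is k.+1 then X k t :: rhist X k t else [::].

Fixpoint mart (R : zmodType) (Y : Type) (f : seq Y -> Y -> R) (s : seq Y) : R :=
  if s is y :: s' then mart f s' + f s' y else 0.

Lemma size_rhist (T Y : Type) (X : nat -> T -> Y) n t : size (rhist X n t) = n.
Proof. by elim: n => //= n ->. Qed.

Lemma nth_rhist (T Y : Type) (X : nat -> T -> Y) n t y0 i : (i < n)%N ->
  nth y0 (rhist X n t) i = X (n - i.+1)%N t.
Proof.
elim: n i => // n IHn [|i] /= ilt; first by rewrite subn1.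
by rewrite IHn// subSS.
Qed.

Lemma mart_rhist (R : zmodType) (T Y : Type) (X : nat -> T -> Y)
    (f : seq Y -> Y -> R) t :
  (fun n => mart f (rhist X n t)) = series (fun k => f (rhist X k t) (X k t)).
Proof.
apply/funext; elim=> [|n IHn] /=; first by rewrite /series/= big_nil.
by rewrite /series/= big_nat_recr//= IHn.
Qed.

(** * Kolmogorov's maximal inequality on finite histories *)

Section Martingale.
Context {R : realType} {d : measure_display} {T : measurableType d}.
Variable Pr : probability T R.

Lemma probability_bigcup_fin_le (Y : finType) (F : Y -> set T) :
  (forall y, measurable (F y)) ->
  (Pr (\bigcup_(y in [set: Y]) F y) <= \sum_(y : Y) Pr (F y))%E.
Proof.
move=> mF.
have -> : \bigcup_(y in [set: Y]) F y = \big[setU/set0]_(y : Y) F y.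
  rewrite (_ : [set: Y] = [set` predT]); last by apply/seteqP; split.
  by rewrite bigcup_pred; apply: eq_bigl.
have : measurable (\big[setU/set0]_(y : Y) F y) /\
    (Pr (\big[setU/set0]_(y : Y) F y) <= \sum_(y : Y) Pr (F y))%E.
  elim/big_rec2 : _ => [|y e B _ [mB le]]; first by rewrite measure0.
  split; first exact: measurableU.
  apply: (le_trans (measureU2 _ (mF y) mB)); exact: leeD2l.
by case.
Qed.

Context {Y : finType}.
Variables (X : nat -> T -> Y) (law : Y -> R).
Hypothesis mX : forall k y, measurable (X k @^-1` [set y]).
Hypothesis iidX : forall (n : nat) (ks : 'I_n -> nat) (ys : 'I_n -> Y),
  injective ks ->
  Pr (\bigcap_(i in [set: 'I_n]) (X (ks i) @^-1` [set ys i]))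
    = (\prod_(i < n) law (ys i))%:E.
Hypothesis law0 : forall y, 0 <= law y.
Hypothesis law1 : \sum_y law y = 1.

(** No condition on [P] is required: histories of a given length take finitely many values. *)
Lemma measurable_rhist (P : seq Y -> Prop) n :
  measurable [set t | P (rhist X n t)].
Proof.
elim: n P => [|n IHn] P /=.
  have [p|np] := pselect (P [::]).
    by rewrite (_ : [set _ | _] = setT) //; apply/seteqP; split.
  by rewrite (_ : [set _ | _] = set0) //; apply/seteqP; split.
rewrite (_ : [set _ | _] = \bigcup_(y in [set: Y])
    (X n @^-1` [set y] `&` [set t | P (y :: rhist X n t)])); last first.
  by apply/seteqP; split => [t Pt|t [y _ [/= <-]]//]; exists (X n t).
apply: fin_bigcup_measurable => // y _.
exact: measurableI (mX _ _) (IHn (fun s => P (y :: s))).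
Qed.

(** The event lies in an intersection of sample events at distinct times. Entry [i] of a reversed
    history is the sample at time [rev_ord i]. *)
Lemma rhist_prob_le (s : seq Y) :
  (Pr [set t | rhist X (size s) t = s] <= (\prod_(y <- s) law y)%:E)%E.
Proof.
rewrite (big_tnth _ _ s).
rewrite -(@iidX _ (fun i => rev_ord i)); last first.
  by move=> i j /val_inj /rev_ord_inj.
apply: le_measure; rewrite ?inE.
- exact: (measurable_rhist (fun u => u = s)).
- by apply: fin_bigcap_measurable => // i _; exact: mX.
- move=> t /= st i _ /=.
  by rewrite (tnth_nth (X 0%N t)) /= -{3}st nth_rhist.
Qed.

Variables (f : seq Y -> Y -> R) (c : nat -> R).
Hypothesis f_mean0 : forall s, \sum_y law y * f s y = 0.
Hypothesis f_var : forall s, \sum_y law y * f s y ^+ 2 <= c (size s).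

Lemma variance_bound_ge0 n : 0 <= c n.
Proof.
(* An inhabitant of [Y] supplies a history of every length; [Y] cannot be empty because [law] has
   total mass 1. *)
have [y _|Y0] := pickP Y; last first.
  by move: law1; rewrite big1 => [/eqP|y]; [rewrite eq_sym oner_eq0 | have := Y0 y].
rewrite -(size_nseq n y); apply: le_trans (f_var _).
by apply: sumr_ge0 => z _; rewrite mulr_ge0// sqr_ge0.
Qed.

(* Kolmogorov's inequality, conditionally on the history [s]: as long as the
   threshold is not reached, conditioning on one more sample only adds
   a variance to [mart f s ^+ 2]. *)
Lemma kolmogorov_from (eps : R) n s : 0 < eps ->
  (Pr [set t | rhist X (size s) t = s /\
       exists2 j, (j <= n)%N & (eps <= `|mart f (rhist X (size s + j) t)|)%R ]
   <= (\prod_(y <- s) law y *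
        ((mart f s ^+ 2 + \sum_(i < n) c (size s + i)) / eps ^+ 2))%:E)%E.
Proof.
move=> eps0.
have P0 u : 0 <= \prod_(y <- u) law y by apply: prodr_ge0.
have mE k (u : seq Y) m : measurable [set t | rhist X k t = u /\
       exists2 j, (j <= m)%N & eps <= `|mart f (rhist X (k + j) t)| ].
  rewrite (_ : [set _ | _] = [set t | rhist X k t = u] `&`
     \bigcup_(j in [set j | (j <= m)%N])
       [set t | eps <= `|mart f (rhist X (k + j) t)|]); last first.
    by apply/seteqP; split => t /= [h [j jm ej]]; split => //; exists j.
  apply: measurableI; first exact: (measurable_rhist (fun v => v = u)).
  apply: bigcup_measurable => j _.
  exact: (measurable_rhist (fun v => eps <= `|mart f v|)).
(* Once the threshold is met at [u], the factor after the product is at least 1, so the probability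
   of the history alone suffices. *)
have reached m u : eps <= `|mart f u| ->
    (Pr [set t | rhist X (size u) t = u /\
         exists2 j, (j <= m)%N & (eps <= `|mart f (rhist X (size u + j) t)|)%R ]
     <= (\prod_(y <- u) law y *
          ((mart f u ^+ 2 + \sum_(i < m) c (size u + i)) / eps ^+ 2))%:E)%E.
  move=> eu; apply: (@le_trans _ _ (Pr [set t | rhist X (size u) t = u])).
    apply: le_measure; rewrite ?inE; first exact: mE.
      exact: (measurable_rhist (fun v => v = u)).
    by move=> t [].
  apply: (le_trans (rhist_prob_le u)); rewrite lee_fin ler_peMr//.
  rewrite ler_pdivlMr ?exprn_gt0// mul1r.
  apply: (@le_trans _ _ (mart f u ^+ 2)).
    by rewrite -(real_normK (num_real (mart f u))) ler_sqr ?nnegrE// ltW.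
  by rewrite lerDl; apply: sumr_ge0 => i _; exact: variance_bound_ge0.
elim: n s => [|n IHn] s; have [/reached//|es] := leP eps `|mart f s|.
- rewrite (_ : [set _ | _] = set0); last first.
    apply/seteqP; split => // t [/= st [j]]; rewrite leqn0 => /eqP ->.
    by rewrite addn0 st leNgt es.
  rewrite measure0 lee_fin big_ord0 addr0 mulr_ge0// divr_ge0 ?sqr_ge0//.
(* Below the threshold at [s], the crossing happens at some [j >= 1]; it is split according to the
   next sample [y], leaving a horizon [n]. *)
pose F y := [set t | rhist X (size (y :: s)) t = y :: s /\
       exists2 j, (j <= n)%N &
         eps <= `|mart f (rhist X (size (y :: s) + j) t)| ].
apply: (@le_trans _ _ (Pr (\bigcup_(y in [set: Y]) F y))).
  apply: le_measure; rewrite ?inE.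
  - exact: mE.
  - by apply: fin_bigcup_measurable => // y _; exact: mE.
  - move=> t [/= st [[|j] jn]].
      by rewrite addn0 st leNgt es.
    move=> ej; exists (X (size s) t) => //; split; first by rewrite /= st.
    by exists j => //; rewrite addSnnS.
apply: (le_trans (probability_bigcup_fin_le (F := F) (fun y => mE _ _ _))).
apply: (@le_trans _ _ (\sum_(y : Y) (\prod_(z <- y :: s) law z *
   ((mart f (y :: s) ^+ 2 + \sum_(i < n) c (size (y :: s) + i)) / eps ^+ 2))%:E)%E).
  by apply: lee_sum => y _; exact: IHn.
rewrite sumEFin lee_fin.
set C := \sum_(i < n) c ((size s).+1 + i).
have -> : \sum_(y : Y) (\prod_(z <- y :: s) law z *
      ((mart f (y :: s) ^+ 2 + C) / eps ^+ 2)) =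
    \prod_(z <- s) law z *
      ((\sum_y law y * ((mart f s + f s y) ^+ 2 + C)) / eps ^+ 2).
  rewrite mulr_suml mulr_sumr; apply: eq_bigr => y _.
  by rewrite big_cons /=; ring.
rewrite ler_wpM2l// ler_wpM2r ?invr_ge0 ?sqr_ge0//= big_ord_recl addn0.
set C' := \sum_(i < n) _.
have -> : C' = C by apply: eq_bigr => i _; rewrite addSnnS.
(* Expanding the square, the cross term vanishes by [f_mean0] and the last term is at most
   [c (size s)]. *)
have -> : \sum_(y : Y) law y * ((mart f s + f s y) ^+ 2 + C) =
   (mart f s ^+ 2 + C) * \sum_y law y + mart f s * 2 * (\sum_y law y * f s y)
   + \sum_y law y * f s y ^+ 2.
  rewrite !mulr_sumr -!big_split/=; apply: eq_bigr => y _; ring.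
rewrite law1 f_mean0; have := f_var s; lra.
Qed.

(** The finite-horizon bound from the empty history passes to the limit along the increasing events
    [F n]. *)
Lemma kolmogorov (eps V : R) : 0 < eps -> (forall n, \sum_(i < n) c i <= V) ->
  (Pr [set t | exists j, (eps <= `|mart f (rhist X j t)|)%R]
     <= (V / eps ^+ 2)%:E)%E.
Proof.
move=> eps0 cV.
pose F n := [set t | exists2 j, (j <= n)%N & eps <= `|mart f (rhist X j t)| ].
have mF n : measurable (F n).
  rewrite (_ : F n = \bigcup_(j in [set j | (j <= n)%N])
       [set t | eps <= `|mart f (rhist X j t)|]); last first.
    by apply/seteqP; split => t /= [j jm ej]; exists j.
  apply: bigcup_measurable => j _.
  exact: (measurable_rhist (fun v => eps <= `|mart f v|)).
rewrite (_ : [set _ | _] = \bigcup_n F n); last first.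
  by apply/seteqP; split => t /= [j]; [move=> ej; exists j => //; exists j
                                      | move=> _ [i _ ei]; exists i].
have ndF : {homo F : n m / (n <= m)%N >-> (n <= m)%O}.
  move=> n m nm; apply/subsetPset => t [j jn ej]; exists j => //.
  exact: leq_trans nm.
have cv := nondecreasing_cvg_mu (mu := Pr) mF (bigcup_measurable (fun k _ => mF k)) ndF.
rewrite -(cvg_lim _ cv)//; apply: lime_le; first by apply/cvg_ex; eexists; exact: cv.
apply: nearW => n /=.
have := @kolmogorov_from eps n [::] eps0.
rewrite big_nil mul1r /= expr0n/= add0r.
rewrite (_ : [set _ | _] = F n); last first.
  by apply/seteqP; split => t; [case | move=> ?; split].
move=> /le_trans; apply; rewrite lee_fin ler_wpM2r ?invr_ge0 ?sqr_ge0//.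
under eq_bigr do rewrite add0n.
exact: cV.
Qed.

End Martingale.

(** * Almost sure convergence under summable variances *)

Section MartingaleConvergence.
Context {R : realType} {d : measure_display} {T : measurableType d}.
Variable Pr : probability T R.
Context {Y : finType}.
Variables (X : nat -> T -> Y) (law : Y -> R).
Hypothesis mX : forall k y, measurable (X k @^-1` [set y]).
Hypothesis iidX : forall (n : nat) (ks : 'I_n -> nat) (ys : 'I_n -> Y),
  injective ks ->
  Pr (\bigcap_(i in [set: 'I_n]) (X (ks i) @^-1` [set ys i]))
    = (\prod_(i < n) law (ys i))%:E.
Hypothesis law0 : forall y, 0 <= law y.
Hypothesis law1 : \sum_y law y = 1.
Variables (f : seq Y -> Y -> R) (c : nat -> R).
Hypothesis f_mean0 : forall s, \sum_y law y * f s y = 0.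
Hypothesis f_var : forall s, \sum_y law y * f s y ^+ 2 <= c (size s).

(** Silencing the first [m] increments restarts the martingale at time [m], so the maximal
    inequality bounds its later oscillation. *)
Let delayed m (s : seq Y) y := if (m <= size s)%N then f s y else 0.

Let mart_delayed m n t : (m <= n)%N ->
  mart (delayed m) (rhist X n t) = mart f (rhist X n t) - mart f (rhist X m t).
Proof.
have mart0 k : (k <= m)%N -> mart (delayed m) (rhist X k t) = 0.
  elim: k => //= k IHk km.
  by rewrite IHk ?(ltnW km)// /delayed size_rhist leqNgt km addr0.
move=> /subnKC <-; elim: (n - m)%N => [|k IHk].
  by rewrite addn0 subrr mart0.
by rewrite addnS /= IHk /delayed size_rhist leq_addr; ring.
Qed.

(** The oscillation after time [m] reaches [eps] with probability at most [V m / eps ^+ 2], where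
    the tail [V m] vanishes. Countably many values of [eps] then make almost every path Cauchy. *)
Lemma mart_ae_cvg : cvgn (series c) ->
  {ae Pr, forall t, cvgn (fun n => mart f (rhist X n t))}.
Proof.
move=> ccv.
pose V m := limn (series c) - series c m.
have c0 := variance_bound_ge0 law0 law1 f_var.
have Vcv : V @ \oo --> (0 : R).
  by rewrite -(subrr (limn (series c))); apply: cvgB => //; exact: cvg_cst.
have serle n : series c n <= limn (series c).
  apply: nondecreasing_cvgn_le => //.
  by apply: nondecreasing_series => k _ _; exact: c0.
have bnd eps m : 0 < eps ->
    (Pr [set t | exists j, (eps <= `|mart (delayed m) (rhist X j t)|)%R]
      <= (V m / eps ^+ 2)%:E)%E.
  move=> eps0.
  apply: (@kolmogorov _ _ _ Pr _ X law mX iidX law0 law1 (delayed m)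
    (fun n => if (m <= n)%N then c n else 0)) => //.
  - move=> s; rewrite /delayed; case: (m <= size s)%N => //.
    by rewrite big1 // => y _; rewrite mulr0.
  - move=> s; rewrite /delayed; case: (m <= size s)%N => //.
    by rewrite big1 // => y _; rewrite expr0n mulr0.
  - move=> n; rewrite /V.
    have [mn|nm] := leqP m n; last first.
      rewrite big1 ?subr_ge0// => i _.
      by rewrite leqNgt (ltn_trans (ltn_ord i) nm).
    rewrite lerBrDl; apply: le_trans (serle n).
    rewrite -(big_mkord xpredT (fun n => if (m <= n)%N then c n else 0)).
    rewrite /series/= !(big_cat_nat (leq0n m) mn)/= lerD2l.
    rewrite big_nat big1 ?add0r; last first.
      by move=> i /andP[_ im]; rewrite leqNgt im.
    by apply: ler_sum_nat => i /andP[-> _].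
have mE (eps : R) m :
    measurable [set t | exists j, eps <= `|mart (delayed m) (rhist X j t)|].
  rewrite (_ : [set _ | _] = \bigcup_j
    [set t | eps <= `|mart (delayed m) (rhist X j t)|]); last first.
    by apply/seteqP; split => t /= [j]; [move=> ?; exists j | move=> _ ?; exists j].
  apply: bigcup_measurable => j _.
  exact: (measurable_rhist mX (fun v => eps <= `|mart (delayed m) v|)).
have aeE : {ae Pr, forall t, forall i, exists m, forall j,
    `|mart (delayed m) (rhist X j t)| < i.+1%:R^-1}.
  apply: ae_foralln => i.
  have i0 : 0 < i.+1%:R^-1 :> R by rewrite invr_gt0.
  (* The paths oscillating after every [m] form a null set, being contained in events of arbitrarily
     small probability. *)
  exists (\bigcap_m [set t | exists j,
     i.+1%:R^-1 <= `|mart (delayed m) (rhist X j t)|]); split.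
  - by apply: bigcap_measurable => // m _; exact: mE.
  - apply/eqP; rewrite eq_le measure_ge0 andbT; apply/lee_addgt0Pr => e e0.
    rewrite add0e.
    have /cvgr0Pnorm_le /(_ _ e0)[m _ /(_ m (leqnn m)) /= Vm] :
       (fun m => V m / i.+1%:R^-1 ^+ 2) @ \oo --> (0 : R).
      by rewrite -(mul0r ((i.+1%:R^-1 ^+ 2)^-1)); apply: cvgM => //; exact: cvg_cst.
    apply: (@le_trans _ _ (V m / i.+1%:R^-1 ^+ 2)%:E); last first.
      by rewrite lee_fin; exact: le_trans (ler_norm _) Vm.
    apply: le_trans (bnd _ m i0); apply: le_measure; rewrite ?inE.
    + by apply: bigcap_measurable => // k _; exact: mE.
    + exact: mE.
    + by move=> t; apply.
  - move=> t /= nt m _ /=; apply: contrapT => nj; apply: nt; exists m => j.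
    by rewrite ltNge; apply/negP => ej; apply: nj; exists j.
apply: filterS aeE => t tP.
apply/cauchy_cvgP/cauchyP => eps eps0.
have [i] := ltr_add_invr eps0; rewrite add0r => ie.
have [m mP] := tP i; exists (mart f (rhist X m t)).
exists m => // n /= mn.
rewrite /ball/= distrC -mart_delayed//.
exact: lt_trans (mP n) ie.
Qed.

End MartingaleConvergence.

(** * Nonexpansiveness of the maximum over actions *)

Section MaxQ.
Context {R : realType} {S A : finType}.
Implicit Types q : S -> A -> R.

(** The witness [a0] excludes the default value 0 of [maxQ]. The fold starts from an actual value of
    [q s], so its result is always attained. *)
Lemma maxQ_attained q s (a0 : A) :
  (exists a, maxQ q s = q s a) /\ forall a, q s a <= maxQ q s.
Proof.
rewrite /maxQ; case: pickP => [a1 _|/(_ a0)//].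
split=> [|a]; last exact: le_bigmax.
elim/big_rec : _ => [|a x _ [a' ->]]; first by exists a1.
by rewrite maxEle; case: ifP => _; [exists a' | exists a].
Qed.

Lemma maxQ_dist q q' s (a0 : A) (B : R) :
  (forall a, `|q s a - q' s a| <= B) -> `|maxQ q s - maxQ q' s| <= B.
Proof.
move=> qB.
have [[a ea] ge] := maxQ_attained q s a0.
have [[a' ea'] ge'] := maxQ_attained q' s a0.
have := qB a; have := qB a'; rewrite !ler_norml => /andP[h1 h2] /andP[h3 h4].
have := ge a'; have := ge' a; rewrite ea ea' => h5 h6.
by apply/andP; split; lra.
Qed.

Lemma maxQ_norm q s (a0 : A) (B : R) :
  (forall a, `|q s a| <= B) -> `|maxQ q s| <= B.
Proof. by move=> qB; have [[a ->] _] := maxQ_attained q s a0. Qed.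

End MaxQ.

Lemma ler_norm_wsum (R : realType) (I : finType) (w F : I -> R) (B : R) :
  (forall i, 0 <= w i) -> \sum_i w i = 1 -> (forall i, `|F i| <= B) ->
  `|\sum_i w i * F i| <= B.
Proof.
move=> w0 w1 FB; apply: (le_trans (ler_norm_sum _ _ _)).
rewrite -[leRHS]mul1r -w1 mulr_suml; apply: ler_sum => i _.
by rewrite normrM (ger0_norm (w0 i)) ler_wpM2l.
Qed.

(** * The recursion on histories and its uniform boundedness *)

Section SGT2.
Context {R : realType} {S A : finType}.
Variables (r : S -> A -> S -> R) (gamma beta : R) (alpha : nat -> R).
Variables (QA0 QB0 : S -> A -> R).
Let Qs : Type := ((S -> A -> R) * (S -> A -> R))%type.
Implicit Types (Q : Qs) (c : bool).

(** A boolean index lets one argument serve both estimators, [~~ c] being the other one. *)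
Definition Qcomp c Q : S -> A -> R := if c then Q.1 else Q.2.

(** The increment without its step size; its value 0 away from the visited pair gives every entry
    the same update formula. *)
Definition td c s a Q (y : S * A * S) : R :=
  if y.1 == (s, a) then
    r s a y.2 + gamma * maxQ (Qcomp (~~ c) Q) y.2 - Qcomp c Q s a
      + beta * (Qcomp (~~ c) Q s a - Qcomp c Q s a)
  else 0.

Lemma Qcomp_step al Q y c s a :
  Qcomp c (sgt2_step r gamma beta al Q y) s a = Qcomp c Q s a + al * td c s a Q y.
Proof.
case: Q y => [qa qb] [[s1 a1] s'].
rewrite /td /Qcomp /sgt2_step /= xpair_eqE (eq_sym s1) (eq_sym a1).
by case: c => /=; case: eqP => [->|_]; case: eqP => [->|_] //=; rewrite mulr0 addr0.
Qed.

Fixpoint sgt2_hist (h : seq (S * A * S)) : Qs :=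
  if h is y :: h' then
    sgt2_step r gamma beta (alpha (size h')) (sgt2_hist h') y
  else (QA0, QB0).

Lemma sgt2_iter_hist (T : Type) (X : nat -> T -> S * A * S) t k :
  sgt2_iter r gamma beta alpha QA0 QB0 (fun n => X n t) k
    = sgt2_hist (rhist X k t).
Proof. by elim: k => //= k ->; rewrite size_rhist. Qed.

Definition Qbounded (B : R) Q := forall c s a, `|Qcomp c Q s a| <= B.

Lemma td_bound (Rm B : R) c s a Q y : 0 <= gamma <= 1 -> 0 <= beta ->
  (forall s a s', `|r s a s'| <= Rm) -> Qbounded B Q ->
  `|td c s a Q y| <= Rm + 2 * (1 + beta) * B.
Proof.
move=> /andP[g0 g1] b0 rR QB.
have B0 : 0 <= B := le_trans (normr_ge0 _) (QB c s a).
have R0 : 0 <= Rm := le_trans (normr_ge0 _) (rR s a y.2).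
rewrite /td; case: ifP => _; last first.
  by rewrite normr0; nra.
have h1 := maxQ_norm a (QB (~~ c) y.2); have h2 := QB c s a.
have h3 := QB (~~ c) s a; have h4 := rR s a y.2.
move: h1 h2 h3 h4; rewrite !ler_norml.
move: (maxQ _ _) (Qcomp c Q s a) (Qcomp (~~ c) Q s a) (r s a y.2) => m q q' x.
move=> /andP[? ?] /andP[? ?] /andP[? ?] /andP[? ?].
have gm : - B <= gamma * m <= B by apply/andP; split; nra.
have bq : - (2 * B) * beta <= beta * (q' - q) <= 2 * B * beta.
  by apply/andP; split; nra.
by move/andP: gm => [? ?]; move/andP: bq => [? ?]; apply/andP; split; lra.
Qed.

Lemma step_bound (Rm B al : R) Q y : 0 <= gamma -> 0 <= beta ->
  0 <= al -> al * (1 + beta) <= 1 ->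
  (forall s a s', `|r s a s'| <= Rm) -> Rm <= (1 - gamma) * B ->
  Qbounded B Q -> Qbounded B (sgt2_step r gamma beta al Q y).
Proof.
move=> g0 b0 al0 al1 rR RB QB c s a; rewrite Qcomp_step /td.
case: ifP => _; last by rewrite mulr0 addr0.
have h1 := maxQ_norm a (QB (~~ c) y.2); have h2 := QB c s a.
have h3 := QB (~~ c) s a; have h4 := rR s a y.2.
move: h1 h2 h3 h4.
move: (maxQ _ _) (Qcomp c Q s a) (Qcomp (~~ c) Q s a) (r s a y.2) => m q q' x.
move=> h1 h2 h3 h4.
have -> : q + al * (x + gamma * m - q + beta * (q' - q)) =
   (1 - al * (1 + beta)) * q + al * (x + (gamma * m + beta * q')) by ring.
have h5 : `|x + (gamma * m + beta * q')| <= (1 + beta) * B.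
  apply: (le_trans (ler_normD _ _)).
  (* The hypothesis [Rm <= (1 - gamma) * B] absorbs the reward here. *)
  apply: (@le_trans _ _ (Rm + (gamma * B + beta * B))); last by lra.
  apply: lerD => //; apply: (le_trans (ler_normD _ _)).
  by rewrite !normrM (ger0_norm g0) (ger0_norm b0) lerD// ler_wpM2l.
apply: (le_trans (ler_normD _ _)); rewrite !normrM (ger0_norm al0).
rewrite (@ger0_norm _ (1 - _)) ?subr_ge0//.
apply: (@le_trans _ _ ((1 - al * (1 + beta)) * B + al * ((1 + beta) * B))).
  by rewrite lerD// ler_wpM2l// subr_ge0.
by lra.
Qed.

(** Up to a fixed time [K] the bound grows by a controlled amount per step, uniformly in the
    samples; afterwards [step_bound] keeps it invariant. *)
Lemma sgt2_hist_bounded : 0 <= gamma -> gamma < 1 -> 0 <= beta ->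
  (forall k, 0 <= alpha k <= 1) -> alpha @ \oo --> 0 ->
  exists B, forall h, Qbounded B (sgt2_hist h).
Proof.
move=> g0 g1 b0 al01 alcv.
pose Rm : R := \sum_y `|r y.1.1 y.1.2 y.2|.
have rR s a s' : `|r s a s'| <= Rm.
  exact: (ler_norm_total (fun y => r y.1.1 y.1.2 y.2) (s, a, s')).
have [K _ KP] : \forall k \near \oo, alpha k * (1 + beta) <= 1.
  have /cvgr0Pnorm_le : (fun k => alpha k * (1 + beta)) @ \oo --> (0 : R).
    by rewrite -(mul0r (1 + beta)); apply: cvgM => //; exact: cvg_cst.
  by move=> /(_ 1 ltr01); apply: filterS => k; apply: le_trans; exact: ler_norm.
have early n : exists B, forall h, (size h <= n)%N -> Qbounded B (sgt2_hist h).
  elim: n => [|n [B IHn]].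
    exists (\sum_i `|Qcomp i.1 (QA0, QB0) i.2.1 i.2.2|) => -[|//] _ c s a /=.
    exact: (ler_norm_total
      (fun i => Qcomp i.1 (QA0, QB0) i.2.1 i.2.2) (c, (s, a))).
  exists (B + (Rm + 2 * (1 + beta) * B)) => -[|y h] /= hn c s a.
    have hB : Qbounded B (sgt2_hist [::]) by exact: IHn.
    have B0 : 0 <= B := le_trans (normr_ge0 _) (hB c s a).
    have R0 : 0 <= Rm := le_trans (normr_ge0 _) (rR s a s).
    by apply: (le_trans (hB c s a)); rewrite lerDl; nra.
  have hB := IHn h hn.
  rewrite Qcomp_step; apply: (le_trans (ler_normD _ _)); apply: lerD => //.
  have /andP[al0 al1] := al01 (size h).
  rewrite normrM (ger0_norm al0).
  apply: le_trans (@td_bound Rm B c s a _ y _ b0 rR hB); last by rewrite g0 ltW.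
  by rewrite ler_piMl.
have [B0 B0P] := early K.
(* The first term covers the early phase, the second makes the ball large enough to be invariant. *)
pose B := Num.max B0 (Rm / (1 - gamma)).
have RB : Rm <= (1 - gamma) * B.
  by rewrite mulrC -ler_pdivrMr ?subr_gt0// /B le_max lexx orbT.
exists B => h.
have [hK|Kh] := leqP (size h) K.
  by move=> c s a; apply: (le_trans (B0P h hK c s a)); rewrite /B le_max lexx.
elim: h Kh => // y h IHh /= Kh.
have /andP[al0 al1] := al01 (size h).
apply: (@step_bound Rm) => //; first exact: KP.
move: Kh; rewrite ltnS leq_eqVlt => /orP[/eqP Kh|]; last exact: IHh.
by move=> c s a; apply: (le_trans (B0P h _ c s a)); rewrite ?Kh// /B le_max lexx.
Qed.

End SGT2.

Lemma cvg_sqr0 (R : realType) (u : nat -> R) :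
  (fun k => u k ^+ 2) @ \oo --> 0 -> u @ \oo --> 0.
Proof.
move=> /cvgr0Pnorm_le u2; apply/cvgr0Pnorm_le => e e0.
have := u2 _ (exprn_gt0 2 e0); apply: filterS => k.
by rewrite normrX ler_sqr// nnegrE ltW.
Qed.

(** * Expected update and its contraction *)

Section MeanDynamics.
Context {R : realType} {S A : finType}.
Variables (Ptr r : S -> A -> S -> R) (gamma beta : R) (Qstar : S -> A -> R).
Variables (p : S -> R) (b : S -> A -> R).
Hypothesis Ptr0 : forall s a s', 0 <= Ptr s a s'.
Hypothesis Ptr1 : forall s a, \sum_(s' : S) Ptr s a s' = 1.
Hypothesis gamma0 : 0 <= gamma.
Hypothesis beta0 : 0 < beta.
Hypothesis QstarE : forall s a, Qstar s a =
  \sum_(s' : S) Ptr s a s' * (r s a s' + gamma * maxQ Qstar s').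

Let law : S * A * S -> R :=
  fun x => let: (s, a, s') := x in p s * b s a * Ptr s a s'.

Lemma sum_law : \sum_s p s = 1 -> (forall s, \sum_a b s a = 1) ->
  \sum_y law y = 1.
Proof.
move=> p1 b1.
transitivity (\sum_(s : S) \sum_(a : A) \sum_(s' : S) law (s, a, s')).
  by rewrite !pair_bigA; apply: eq_bigr => -[[]].
rewrite -p1; apply: eq_bigr => s _.
rewrite -[RHS]mulr1 -(b1 s) mulr_sumr; apply: eq_bigr => a _.
by rewrite -mulr_sumr Ptr1 mulr1.
Qed.

(** This is [H_k] in error coordinates; dividing by [1 + beta] gives the entry's own error
    coefficient -1 beside it. *)
Definition mean_target c s a (Q : (S -> A -> R) * (S -> A -> R)) : R :=
  (gamma * (\sum_s' Ptr s a s' * (maxQ (Qcomp (~~ c) Q) s' - maxQ Qstar s'))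
    + beta * (Qcomp (~~ c) Q s a - Qstar s a)) / (1 + beta).

(** Only samples visiting [(s, a)] contribute, and the Bellman equation for [Qstar] eliminates the
    mean reward. *)
Lemma mean_td c s a Q : \sum_y law y * td r gamma beta c s a Q y =
  p s * b s a * (1 + beta) *
    (mean_target c s a Q - (Qcomp c Q s a - Qstar s a)).
Proof.
transitivity (\sum_(sa : S * A) \sum_(s' : S)
    law (sa, s') * td r gamma beta c s a Q (sa, s')).
  by rewrite pair_bigA; apply: eq_bigr => -[].
rewrite (bigD1 (s, a))//= [X in _ + X]big1 ?addr0; last first.
  by move=> i /negbTE ia; rewrite big1// => s' _; rewrite /td/= ia mulr0.
under eq_bigr => s' _ do rewrite /td/= eqxx -mulrA.
rewrite -mulr_sumr -[RHS]mulrA; congr (_ * _).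
rewrite [RHS]mulrBr {1}/mean_target [X in _ = X - _]mulrC divfK; last first.
  by rewrite gt_eqF// addr_gt0.
set q := Qcomp c Q s a; set q' := Qcomp (~~ c) Q s a.
have -> : \sum_s' Ptr s a s' *
    (r s a s' + gamma * maxQ (Qcomp (~~ c) Q) s' - q + beta * (q' - q)) =
  \sum_s' Ptr s a s' * (r s a s' + gamma * maxQ Qstar s')
  + gamma * (\sum_s' Ptr s a s' * (maxQ (Qcomp (~~ c) Q) s' - maxQ Qstar s'))
  + (beta * (q' - q) - q) * \sum_s' Ptr s a s'.
  by rewrite !mulr_sumr -!big_split/=; apply: eq_bigr => s' _; ring.
rewrite -QstarE Ptr1; ring.
Qed.

Lemma mean_target_contraction Q (B : R) :
  (forall c s a, `|Qcomp c Q s a - Qstar s a| <= B) ->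
  forall c s a, `|mean_target c s a Q| <= (gamma + beta) / (1 + beta) * B.
Proof.
move=> QB c s a.
have b1 : 0 <= (1 + beta)^-1 by rewrite invr_ge0 addr_ge0// ltW.
rewrite /mean_target normrM (ger0_norm b1) mulrAC ler_wpM2r//.
apply: (le_trans (ler_normD _ _)); rewrite !normrM (ger0_norm gamma0).
rewrite (gtr0_norm beta0) mulrDl lerD// ler_wpM2l ?(ltW beta0)//.
by apply: ler_norm_wsum => // s'; exact: (maxQ_dist a).
Qed.

End MeanDynamics.

Theorem theorem4 (R : realType) (d : measure_display) (T : measurableType d)
  (Pr : probability T R) (S A : finType)
  (Ptr : S -> A -> S -> R) (r : S -> A -> S -> R) (gamma beta : R)
  (Qstar : S -> A -> R) (p : S -> R) (b : S -> A -> R)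
  (X : nat -> T -> S * A * S) (alpha : nat -> R) (QA0 QB0 : S -> A -> R) :
  (forall s a s', 0 <= Ptr s a s') ->
  (forall s a, \sum_(s' : S) Ptr s a s' = 1) ->
  0 <= gamma -> gamma < 1 ->
  (forall s a, Qstar s a =
     \sum_(s' : S) Ptr s a s' * (r s a s' + gamma * maxQ Qstar s')) ->
  0 < beta ->
  (forall s, 0 <= p s) -> \sum_(s : S) p s = 1 ->
  (forall s a, 0 <= b s a) -> (forall s, \sum_(a : A) b s a = 1) ->
  (forall s a, 0 < p s * b s a) ->
  iid_samples Pr X (fun x => let: (s, a, s') := x in p s * b s a * Ptr s a s') ->
  (forall k, 0 <= alpha k <= 1) ->
  series alpha @ \oo --> +oo ->
  cvgn (series (fun k => alpha k ^+ 2)) ->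
  {ae Pr, forall t, forall s a,
     (fun k => (sgt2_iter r gamma beta alpha QA0 QB0 (fun n => X n t) k).1 s a)
       @ \oo --> Qstar s a /\
     (fun k => (sgt2_iter r gamma beta alpha QA0 QB0 (fun n => X n t) k).2 s a)
       @ \oo --> Qstar s a}.
Proof.
move=> Ptr0 Ptr1 g0 g1 QstarE beta0 p0 p1 b0 b1 pb0 [mX iidX] al01 alS al2.
pose law (x : S * A * S) : R := let: (s, a, s') := x in p s * b s a * Ptr s a s'.
have law0 y : 0 <= law y by case: y => [[s a] s']; rewrite /law !mulr_ge0.
have law1 : \sum_y law y = 1 by exact: sum_law.
have al0 k : 0 <= alpha k by have /andP[] := al01 k.
have alcv : alpha @ \oo --> 0 by apply: cvg_sqr0; exact: cvg_series_cvg_0.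
have [B QB] := sgt2_hist_bounded r QA0 QB0 g0 g1 (ltW beta0) al01 alcv.
pose Qh := sgt2_hist r gamma beta alpha QA0 QB0.
pose tdm (i : bool * (S * A)) h y := td r gamma beta i.1 i.2.1 i.2.2 (Qh h) y.
(* The noise is the increment minus its mean given the history [h]. *)
pose xi i h y := tdm i h y - \sum_z law z * tdm i h z.
pose Rm : R := \sum_y `|r y.1.1 y.1.2 y.2|.
have rR s a s' : `|r s a s'| <= Rm.
  exact: (ler_norm_total (fun y => r y.1.1 y.1.2 y.2) (s, a, s')).
pose C := Rm + 2 * (1 + beta) * B.
have tdC i h y : `|tdm i h y| <= C.
  have g01 : 0 <= gamma <= 1 by rewrite g0 ltW.
  exact: td_bound g01 (ltW beta0) rR (QB h).
have xiC i h y : `|xi i h y| <= 2 * C.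
  apply: (le_trans (ler_normB _ _)).
  have := tdC i h y.
  have : `|\sum_z law z * tdm i h z| <= C by exact: ler_norm_wsum.
  by lra.
have noise : {ae Pr, forall t, forall i,
    cvgn (series (fun k => alpha k * xi i (rhist X k t) (X k t)))}.
  apply: filter_forall => i.
  (* The length of [h] is the current time, so the step size is a function of the history. *)
  pose f h y := alpha (size h) * xi i h y.
  have := @mart_ae_cvg _ _ _ Pr _ X law mX iidX law0 law1 f
    (fun k => alpha k ^+ 2 * (2 * C) ^+ 2).
  have f0 h : \sum_y law y * f h y = 0.
    rewrite /f; under eq_bigr do rewrite mulrCA.
    rewrite -mulr_sumr /xi; under eq_bigr do rewrite mulrBr.
    by rewrite sumrB -mulr_suml law1 mul1r subrr mulr0.
  have fv h : \sum_y law y * f h y ^+ 2 <= alpha (size h) ^+ 2 * (2 * C) ^+ 2.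
    apply: le_trans (ler_norm _) _; apply: ler_norm_wsum => // y.
    rewrite /f exprMn normrM ger0_norm ?sqr_ge0// ler_wpM2l ?sqr_ge0//.
    by rewrite normrX lerXn2r ?nnegrE// (le_trans (normr_ge0 _) (xiC i h y)).
  have ccv : cvgn (series (fun k => alpha k ^+ 2 * (2 * C) ^+ 2)).
    rewrite (_ : series _ =
        (fun n => series (fun k => alpha k ^+ 2) n * (2 * C) ^+ 2)).
      by apply: is_cvgM => //; exact: is_cvg_cst.
    by apply/funext => n; rewrite /series/= mulr_suml.
  move=> /(_ f0 fv ccv); apply: filterS => t; rewrite mart_rhist.
  by congr (cvgn (series _)); apply/funext => k; rewrite /f size_rhist.
apply: filterS noise => t noise s a.
pose e k (i : bool * (S * A)) :=
  Qcomp i.1 (Qh (rhist X k t)) i.2.1 i.2.2 - Qstar i.2.1 i.2.2.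
suff ecv i : e ^~ i @ \oo --> 0.
  have cv c : (fun k => Qcomp c (Qh (rhist X k t)) s a) @ \oo --> Qstar s a.
    rewrite -[Qstar s a]add0r.
    rewrite (_ : (fun k => _) = (fun k => e k (c, (s, a)) + Qstar s a)).
      by apply: cvgD; [exact: ecv | exact: cvg_cst].
    by apply/funext => k; rewrite /e subrK.
  by split; under eq_fun do rewrite sgt2_iter_hist; [exact: cv true | exact: cv false].
pose c := (gamma + beta) / (1 + beta).
have b1_gt0 : 0 < 1 + beta by lra.
apply: (@noisy_contraction_cvg0 _ _ e
  (fun k i => mean_target Ptr gamma beta Qstar i.1 i.2.1 i.2.2 (Qh (rhist X k t)))
  (fun k i => xi i (rhist X k t) (X k t))
  (fun i => p i.2.1 * b i.2.1 i.2.2 * (1 + beta)) alpha c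
  (B + \sum_sa `|Qstar sa.1 sa.2|)) => //.
(* Positivity of [p s * b s a] makes every coordinate contract at a positive rate. *)
- by move=> j; rewrite mulr_gt0.
- by rewrite divr_ge0 ?addr_ge0 ?(ltW beta0) ?(ltW b1_gt0).
- by rewrite /c ltr_pdivrMr// mul1r ltrD2r.
- move=> k [c' [s' a']]; rewrite /e /xi /tdm /=.
  have -> : \sum_z law z * td r gamma beta c' s' a' (Qh (rhist X k t)) z = _ :=
    mean_td p b Ptr1 beta0 QstarE _ _ _ _.
  rewrite Qcomp_step size_rhist.
  by rewrite -/Qh; ring.
- move=> k D D0 eD [c' [s' a']]; apply: mean_target_contraction => //=.
  by move=> c1 s1 a1; exact: (eD (c1, (s1, a1))).
- move=> k [c' [s' a']]; apply: (le_trans (ler_normB _ _)).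
  apply: lerD; first exact: QB.
  exact: (ler_norm_total (fun sa => Qstar sa.1 sa.2) (s', a')).
Qed.
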